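(* Let $f:\mathbb{R}^n\times\mathbb{R}^N\to\mathbb{R}^n$ be continuous, let $\xi_1\in(0,1)$, $\xi_2<0$, $\varepsilon_0>0$, and consider the closed-loop system $$\dot x=f(x,u),\qquad \dot u=-\phi_\xi\big(\mathcal{G}_\theta(x,u)\big),\qquad \dot\theta=\varepsilon_0\Pi(\theta),\ \theta\in\Theta,$$ with $x\in\mathbb{R}^n$, $u\in\mathbb{R}^N$, $\theta\in\mathbb{R}^m$. Assume: (A1) there exist a $\mathcal{C}^1$, $\ell$-Lipschitz map $h:\mathbb{R}^N\to\mathbb{R}^n$ and constants $\gamma,\ell>0$ such that $f(h(u),u)=0$ for all $u\in\mathbb{R}^N$, and there exist $a>0$, $p\in(0,1)$, $q>1$ such that for all $x\in\mathbb{R}^n$ and $u,\hat u\in\mathbb{R}^N$: if $|x-h(\hat u)|\ge\gamma|u-\hat u|$ then $(x-h(\hat u))^\top f(x,u)\le-\frac a2|x-h(\hat u)|^{2p}-\frac a2|x-h(\hat u)|^{2q}$; (A2) $\Pi:\mathbb{R}^m\to\mathbb{R}^m$ is Lipschitz continuous and $\Theta\subset\mathbb{R}^m$ is compact and forward invariant under $\dot\theta=\varepsilon_0\Pi(\theta)$; (A3) the map $u\mapsto\Phi_\theta(u):=\phi_\theta(h(u),u)$ is $\mathcal{C}^1$, $L$-smooth and $\mu$-strongly convex uniformly in $\theta$, i.e. there exist $L,\mu>0$ with $|\nabla\Phi_\theta(\hat u)-\nabla\Phi_\theta(u)|\le L|\hat u-u|$ and $\Phi_\theta(\hat u)\ge\Phi_\theta(u)+\nabla\Phi_\theta(u)^\top(\hat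 u-u)+\frac\mu2|\hat u-u|^2$ for all $u,\hat u\in\mathbb{R}^N$ and all $\theta$; and there exists a $\mathcal{C}^1$ map $\varphi:\mathbb{R}^m\to\mathbb{R}^N$ with $\varphi(\theta)=\arg\min_u\Phi_\theta(u)$; (A4) there exists $K>0$ with $|\mathcal{G}_\theta(\hat x,u)-\mathcal{G}_\theta(x,u)|\le K|\hat x-x|$ for all $x,\hat x\in\mathbb{R}^n$, $u\in\mathbb{R}^N$, $\theta\in\mathbb{R}^m$. If moreover $\mu>K(\ell+\gamma)$, then there exist $\beta\in\mathcal{KL}_{\mathrm{FxT}}$ and $\varrho\in\mathcal{K}$ such that for each $x(0)\in\mathbb{R}^n$, $u(0)\in\mathbb{R}^N$, $\theta(0)\in\Theta$, every solution satisfies, for all $t\ge0$, $$\left|\begin{bmatrix}x(t)-h(\varphi(\theta(t)))\\ u(t)-\varphi(\theta(t))\end{bmatrix}\right|\le\beta\left(\left|\begin{bmatrix}x(0)-h(\varphi(\theta(0)))\\ u(0)-\varphi(\theta(0))\end{bmatrix}\right|,t\right)+\varrho\Big(\sup_{s\ge0}|\varepsilon_0\Pi(\theta(s))|\Big).$$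
   Context: $\phi_\theta:\mathbb{R}^n\times\mathbb{R}^N\to\mathbb{R}$ is a $\mathcal{C}^1$ cost function depending on a parameter $\theta\in\mathbb{R}^m$, and $\nabla\phi_\theta(x,u)\in\mathbb{R}^{n+N}$ is its gradient in $(x,u)$. $\mathcal{G}_\theta(x,u):=H(u)^\top\nabla\phi_\theta(x,u)$ where $H(u)^\top=[\,J_h(u)^\top\ \ I_N\,]$ and $J_h(u)\in\mathbb{R}^{n\times N}$ is the Jacobian of $h$. The map $\phi_\xi:\mathbb{R}^N\to\mathbb{R}^N$ is $\phi_\xi(s)=\frac{s}{|s|^{\xi_1}}+\frac{s}{|s|^{\xi_2}}$ for $s\ne0$ and $\phi_\xi(0)=0$ (continuous). Classes: $\mathcal{K}$ is the set of continuous strictly increasing $\alpha:\mathbb{R}_{\ge0}\to\mathbb{R}_{\ge0}$ with $\alpha(0)=0$. A continuous $\beta:\mathbb{R}_{\ge0}\times\mathbb{R}_{\ge0}\to\mathbb{R}_{\ge0}$ is of class $\mathcal{KL}_{\mathrm{FxT}}$ if $\beta(\cdot,0)\in\mathcal{K}$, each $\beta(r,\cdot)$ is continuous and non-increasing, and there is a continuous, uniformly bounded $T:\mathbb{R}_{\ge0}\to\mathbb{R}_{\ge0}$ with $T(0)=0$ and $\beta(r,t)=0$ for $t\ge T(r)$. $|\cdot|$ is the Euclidean norm. *)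

(* Defs.v *)
From HB Require Import structures.
From mathcomp Require Import all_boot all_order all_algebra.
From mathcomp Require Import all_classical all_reals all_analysis.
Set Implicit Arguments. Unset Strict Implicit. Unset Printing Implicit Defensive.
Import Order.TTheory GRing.Theory Num.Theory.
Import numFieldNormedType.Exports.
Local Open Scope classical_set_scope.
Local Open Scope ring_scope.

Section Defs.
Variable R : realType.

(* Euclidean norm on row vectors (the library norm on matrices is the max norm). *)
Definition enorm (k : nat) (v : 'rV[R]_k) : R := Num.sqrt (\sum_(i < k) v 0 i ^+ 2).

Definition grad (k : nat) (f : 'rV[R]_k -> R) (z : 'rV[R]_k) : 'rV[R]_k :=
  \row_(i < k) ('D_(delta_mx 0 i) f z).

Definition jacobian (a b : nat) (h : 'rV[R]_a -> 'rV[R]_b) (u : 'rV[R]_a)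
  : 'M[R]_(b, a) := \matrix_(i < b, j < a) ('D_(delta_mx 0 j) h u) 0 i.

Definition C1s (k : nat) (f : 'rV[R]_k -> R) : Prop :=
  (forall z, differentiable f z) /\ continuous (grad f).
Definition C1v (a b : nat) (h : 'rV[R]_a -> 'rV[R]_b) : Prop :=
  (forall z, differentiable h z) /\ continuous (jacobian h).

(* G_theta(x,u) = H(u)^T grad phi_theta(x,u) = J_h(u)^T grad_x phi + grad_u phi,
   written with row vectors; phi_theta(x,u) is encoded as phi theta (row_mx x u). *)
Definition Gmap (m n N : nat) (phi : 'rV[R]_m -> 'rV[R]_(n + N) -> R)
  (h : 'rV[R]_N -> 'rV[R]_n) (theta : 'rV[R]_m) (x : 'rV[R]_n) (u : 'rV[R]_N)
  : 'rV[R]_N :=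
  let g := grad (phi theta) (row_mx x u) in
  lsubmx g *m jacobian h u + rsubmx g.

Definition phixi (N : nat) (xi1 xi2 : R) (s : 'rV[R]_N) : 'rV[R]_N :=
  if s == 0 then 0
  else ((enorm s `^ xi1)^-1) *: s + ((enorm s `^ xi2)^-1) *: s.

Definition classK (alpha : R -> R) : Prop :=
  {within `[0, +oo[, continuous alpha} /\ alpha 0 = 0 /\
  (forall r, 0 <= r -> 0 <= alpha r) /\
  (forall r s, 0 <= r -> r < s -> alpha r < alpha s).

Definition classKLFxT (beta : R -> R -> R) : Prop :=
  {within [set z : R * R | 0 <= z.1 /\ 0 <= z.2],
      continuous (fun z : R * R => beta z.1 z.2)} /\
  (forall r t, 0 <= r -> 0 <= t -> 0 <= beta r t) /\
  classK (fun r => beta r 0) /\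
  (forall r, 0 <= r -> {within `[0, +oo[, continuous (beta r)}) /\
  (forall r t s, 0 <= r -> 0 <= t -> t <= s -> beta r s <= beta r t) /\
  (exists T : R -> R,
      {within `[0, +oo[, continuous T} /\
      (forall r, 0 <= r -> 0 <= T r) /\
      (exists M : R, forall r, 0 <= r -> T r <= M) /\
      T 0 = 0 /\
      (forall r t, 0 <= r -> 0 <= t -> T r <= t -> beta r t = 0)).

Definition fwd_solution (k : nat) (F : 'rV[R]_k -> 'rV[R]_k) (z : R -> 'rV[R]_k)
  : Prop :=
  {within `[0, +oo[, continuous z} /\
  (forall t : R, 0 < t -> is_derive t (1 : R) z (F (z t))).

Definition fwd_invariant (m : nat) (F : 'rV[R]_m -> 'rV[R]_m) (Theta : set 'rV[R]_m)
  : Prop :=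
  forall z : R -> 'rV[R]_m, fwd_solution F z -> Theta (z 0) ->
    forall t, 0 <= t -> Theta (z t).

Definition cl_solution (m n N : nat) (f : 'rV[R]_n -> 'rV[R]_N -> 'rV[R]_n)
  (phi : 'rV[R]_m -> 'rV[R]_(n + N) -> R) (h : 'rV[R]_N -> 'rV[R]_n)
  (xi1 xi2 eps0 : R) (Pi : 'rV[R]_m -> 'rV[R]_m) (Theta : set 'rV[R]_m)
  (x : R -> 'rV[R]_n) (u : R -> 'rV[R]_N) (theta : R -> 'rV[R]_m) : Prop :=
  {within `[0, +oo[, continuous x} /\
  {within `[0, +oo[, continuous u} /\
  {within `[0, +oo[, continuous theta} /\
  (forall t : R, 0 < t ->
     is_derive t (1 : R) x (f (x t) (u t)) /\
     is_derive t (1 : R) u (- phixi xi1 xi2 (Gmap phi h (theta t) (x t) (u t))) /\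
     is_derive t (1 : R) theta (eps0 *: Pi (theta t))) /\
  (forall t, 0 <= t -> Theta (theta t)).

End Defs.

(* Main.v *)
(* Let W = |x - h(varphi theta)|, V = |u - varphi theta| and U = max(W, gamma V).  Where
   W >= gamma V, (A1) with uh = varphi theta makes W decay.  Where W <= gamma V, the vector
   s = G_theta(x,u) is the gradient of the strongly convex function Phi_theta perturbed by at
   most K(W + ell V) <= K(ell + gamma)V, so that s^T(u - varphi theta) >= cV^2 with
   c = mu - K(ell + gamma) > 0 and V decays.  In both regions the active square S = W^2 or
   (gamma V)^2 satisfies S' <= -kappa(S^p + S^q) + (drift) with p < 1 < q, and the drift, which
   is linear in d = sup |eps0 Pi(theta)| because h o varphi and varphi have bounded derivatives
   on the compact set Theta, is absorbed once U exceeds a fixed multiple of d.  Since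
   S^p + S^q >= S^r for p <= r <= q, all the exponents can be replaced by 1 - eta and 1 + eta
   with a common eta; then y = atan(S^eta) satisfies y' <= -kappa eta, and, since y < pi / 2,
   the drift threshold is reached by the time pi / (2 kappa eta) whatever the initial
   value.  Undoing this substitution gives beta. *)
Require Import Defs.
From HB Require Import structures.
From mathcomp Require Import all_boot all_order all_algebra.
From mathcomp Require Import all_classical all_reals all_analysis.
From mathcomp Require Import ring lra.
Import Order.TTheory GRing.Theory Num.Theory.
Import numFieldNormedType.Exports.
Local Open Scope classical_set_scope.
Local Open Scope ring_scope.

(** * Euclidean inner product and norm of row vectors *)

Section EuclideanNorm.
Set Implicit Arguments.
Unset Strict Implicit.
Unset Printing Implicit Defensive.
Variable R : realType.
Implicit Types k : nat.

(** Kept as a matrix product so that the scalar products in the hypotheses of the theorem are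
    convertible to it. *)
Definition dot k (a b : 'rV[R]_k) : R := (a *m b^T) 0 0.

Lemma dotE k (a b : 'rV[R]_k) : dot a b = \sum_i a 0 i * b 0 i.
Proof. by rewrite /dot mxE; apply: eq_bigr => i _; rewrite mxE. Qed.

Lemma dotC k (a b : 'rV[R]_k) : dot a b = dot b a.
Proof. by rewrite !dotE; apply: eq_bigr => i _; rewrite mulrC. Qed.

Lemma dotDl k (a b c : 'rV[R]_k) : dot (a + b) c = dot a c + dot b c.
Proof. by rewrite /dot mulmxDl mxE. Qed.

Lemma dotZl k x (a b : 'rV[R]_k) : dot (x *: a) b = x * dot a b.
Proof. by rewrite /dot -scalemxAl mxE. Qed.

Lemma dotNl k (a b : 'rV[R]_k) : dot (- a) b = - dot a b.
Proof. by rewrite /dot mulNmx mxE. Qed.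

Lemma dotBl k (a b c : 'rV[R]_k) : dot (a - b) c = dot a c - dot b c.
Proof. by rewrite dotDl dotNl. Qed.

Lemma dotDr k (a b c : 'rV[R]_k) : dot c (a + b) = dot c a + dot c b.
Proof. by rewrite dotC dotDl !(dotC c). Qed.

Lemma dotZr k x (a b : 'rV[R]_k) : dot a (x *: b) = x * dot a b.
Proof. by rewrite dotC dotZl dotC. Qed.

Lemma dotNr k (a b : 'rV[R]_k) : dot a (- b) = - dot a b.
Proof. by rewrite dotC dotNl dotC. Qed.

Lemma dotBr k (a b c : 'rV[R]_k) : dot c (a - b) = dot c a - dot c b.
Proof. by rewrite dotDr dotNr. Qed.

Lemma dot_ge0 k (a : 'rV[R]_k) : 0 <= dot a a.
Proof. by rewrite dotE sumr_ge0// => i _; rewrite -expr2 sqr_ge0. Qed.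

Lemma enorm_ge0 k (a : 'rV[R]_k) : 0 <= enorm a.
Proof. exact: sqrtr_ge0. Qed.

Lemma enorm_sqr k (a : 'rV[R]_k) : enorm a ^+ 2 = dot a a.
Proof.
rewrite /enorm sqr_sqrtr; first by rewrite dotE; apply: eq_bigr => i _; rewrite expr2.
by rewrite sumr_ge0// => i _; rewrite sqr_ge0.
Qed.

Lemma enormE k (a : 'rV[R]_k) : enorm a = Num.sqrt (dot a a).
Proof. by rewrite -enorm_sqr sqrtr_sqr ger0_norm// enorm_ge0. Qed.

Lemma coord_le_enorm k (a : 'rV[R]_k) i : `|a 0 i| <= enorm a.
Proof.
rewrite -ler_sqr ?nnegrE ?enorm_ge0 ?normr_ge0// enorm_sqr dotE -normrX.
rewrite (bigD1 i)//= expr2 ger0_norm -?expr2 ?sqr_ge0//.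
by rewrite lerDl sumr_ge0// => j _; rewrite -expr2 sqr_ge0.
Qed.

Lemma enorm_eq0 k (a : 'rV[R]_k) : enorm a = 0 -> a = 0.
Proof.
move=> a0; apply/rowP => i; rewrite mxE; apply/eqP; rewrite -normr_le0 -a0.
exact: coord_le_enorm.
Qed.

Lemma enorm0 k : enorm (0 : 'rV[R]_k) = 0.
Proof. by rewrite enormE /dot mul0mx mxE sqrtr0. Qed.

Lemma enormN k (a : 'rV[R]_k) : enorm (- a) = enorm a.
Proof. by rewrite !enormE dotNl dotNr opprK. Qed.

(** Cauchy-Schwarz: the square of [enorm b *: a - enorm a *: b] expands to
    [2 |a| |b| (|a| |b| - dot a b)], and for nonzero vectors the positive factor can be divided
    out. *)
Lemma dot_le_enorm k (a b : 'rV[R]_k) : dot a b <= enorm a * enorm b.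
Proof.
have [/enorm_eq0->|a0] := eqVneq (enorm a) 0.
  by rewrite enorm0 mul0r /dot mul0mx mxE.
have [/enorm_eq0->|b0] := eqVneq (enorm b) 0.
  by rewrite enorm0 mulr0 dotC /dot mul0mx mxE.
have pos : 0 < enorm a * enorm b.
  by rewrite mulr_gt0// lt_neqAle eq_sym ?a0 ?b0 enorm_ge0.
have := dot_ge0 (enorm b *: a - enorm a *: b).
rewrite dotBl !dotBr !dotZl !dotZr -!enorm_sqr (dotC b a) => H.
rewrite -subr_ge0 -(pmulr_rge0 _ pos).
by nra.
Qed.

Lemma oppr_dot_le_enorm k (a b : 'rV[R]_k) : - dot a b <= enorm a * enorm b.
Proof. by rewrite -dotNl -(enormN a) dot_le_enorm. Qed.

Lemma ler_enormD k (a b : 'rV[R]_k) : enorm (a + b) <= enorm a + enorm b.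
Proof.
rewrite -ler_sqr ?nnegrE ?addr_ge0 ?enorm_ge0// enorm_sqr dotDl !dotDr (dotC b a).
rewrite -!enorm_sqr; have := dot_le_enorm a b.
by nra.
Qed.

Lemma enorm_row_mx k l (a : 'rV[R]_k) (b : 'rV[R]_l) :
  enorm (row_mx a b) ^+ 2 = enorm a ^+ 2 + enorm b ^+ 2.
Proof. by rewrite !enorm_sqr /dot tr_row_mx mul_row_col mxE. Qed.

(** The factor [k] instead of its square root is crude, but the bounds on compact sets only ask for
    some constant. *)
Lemma enorm_le_coord k (a : 'rV[R]_k) (B : R) :
  0 <= B -> (forall i, `|a 0 i| <= B) -> enorm a <= k%:R * B.
Proof.
move=> B0 aB; rewrite -ler_sqr ?nnegrE ?enorm_ge0 ?mulr_ge0// enorm_sqr dotE.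
apply: (@le_trans _ _ (\sum_(i < k) B ^+ 2)).
  apply: ler_sum => i _; by rewrite -expr2 -real_normK ?num_real// ler_sqr ?nnegrE.
rewrite sumr_const card_ord exprMn -[_ *+ k]mulr_natl.
apply: ler_wpM2r; first exact: sqr_ge0.
by rewrite -natrX ler_nat; case: k {a aB} => // k; rewrite expnS leq_pmulr// expn_gt0.
Qed.

Lemma enormZ k (x : R) (a : 'rV[R]_k) : enorm (x *: a) = `|x| * enorm a.
Proof.
by rewrite !enormE dotZl dotZr mulrA -expr2 sqrtrM ?sqr_ge0// sqrtr_sqr.
Qed.

Lemma enorm_row_mx_le k l (a : 'rV[R]_k) (b : 'rV[R]_l) :
  enorm (row_mx a b) <= enorm a + enorm b.
Proof.
rewrite -ler_sqr ?nnegrE ?addr_ge0 ?enorm_ge0// enorm_row_mx sqrrD.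
have := mulr_ge0 (enorm_ge0 a) (enorm_ge0 b); lra.
Qed.

Lemma enorm_le_row_mx k l (a : 'rV[R]_k) (b : 'rV[R]_l) :
  enorm a <= enorm (row_mx a b) /\ enorm b <= enorm (row_mx a b).
Proof.
by split; rewrite -ler_sqr ?nnegrE ?enorm_ge0// enorm_row_mx ?lerDl ?lerDr sqr_ge0.
Qed.

End EuclideanNorm.

(** * Comparison by one-sided derivatives, and a continuous real power *)

Section ScalarComparison.
Variable R : realType.
Set Implicit Arguments.
Unset Strict Implicit.
Unset Printing Implicit Defensive.

(** Difference quotients near [c] are below [- k]; multiplying by [s - c < 0] reverses the
    inequality. *)
Lemma is_derive_lt_left (f : R -> R) (c df k : R) :
  is_derive c (1 : R) f df -> df < - k ->
  \forall s \near c^'-, f c + k * (c - s) < f s.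
Proof.
move=> fdf dfk.
have /cvgrPdist_lt : (h^-1 *: (f (h *: (1 : R) + c) - f c)) @[h --> 0^'] --> df.
  by have [fd <-] := fdf; exact: fd.
move=> /(_ (- k - df)); rewrite subr_gt0 => /(_ dfk) [e /= e0 He].
near=> s.
have sc : s < c by near: s; exact: nbhs_left_lt.
have := He (s - c); rewrite /ball_ /= sub0r normrN ltr0_norm ?subr_lt0// opprB.
have -> : c - s < e.
  by rewrite ltrBlDl -ltrBlDr; near: s; apply: nbhs_left_gt; rewrite ltrBlDr ltrDl.
rewrite subr_eq0 lt_eqF// => /(_ isT isT).
rewrite [_%:A]mulr1 subrK ltr_norml => /andP[+ _]; rewrite [_ *: _]/GRing.scale/=.
set q := f s - f c => H.
have {}H : (s - c)^-1 * q < - k by lra.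
have -> : f s = f c + q by rewrite /q addrC subrK.
rewrite ltrD2l -[X in _ < X](mulVKf (_ : s - c != 0)) ?subr_eq0 ?lt_eqF//.
by rewrite -opprB mulrN -mulNr mulrC ltr_nM2l// subr_lt0.
Unshelve. all: by end_near. Qed.

(* At a maximum over [0, t] of the excess of [max y1 y2] over the bound, the larger of the two
   functions falls faster than [k], so the excess is larger just before. *)
Lemma max_decay (y1 y2 : R -> R) (k d : R) :
  {within `[0, +oo[, continuous y1} -> {within `[0, +oo[, continuous y2} ->
  (forall t, 0 < t -> d < y1 t -> y2 t <= y1 t ->
     exists2 dy, is_derive t (1 : R) y1 dy & dy < - k) ->
  (forall t, 0 < t -> d < y2 t -> y1 t <= y2 t ->
     exists2 dy, is_derive t (1 : R) y2 dy & dy < - k) ->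
  0 <= k ->
  forall t, 0 <= t -> Num.max (y1 t) (y2 t) <=
    Num.max (Num.max (y1 0) (y2 0) - k * t) d.
Proof.
move=> cy1 cy2 dy1 dy2 k0 T T0.
pose y t := Num.max (y1 t) (y2 t).
pose b t := Num.max (y 0 - k * t) d.
rewrite -/(y T) -/(b T) -/(y 0).
rewrite leNgt; apply/negP => bT.
have sub : `[0, T]%classic `<=` `[0, +oo[%classic.
  by move=> s /=; rewrite !in_itv/= andbT => /andP[].
have cG : {within `[0, T], continuous (fun t => y t - b t)}.
  have cmax (T' : topologicalType) (g1 g2 : T' -> R) : continuous g1 -> continuous g2 ->
      continuous (fun t => Num.max (g1 t) (g2 t)).
    by move=> c1 c2 t; exact: (continuous_max (c1 t) (c2 t)).
  apply: within_continuousB; apply: cmax.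
  - exact: continuous_subspaceW cy1.
  - exact: continuous_subspaceW cy2.
  - apply: continuous_subspaceT => t; apply: cvgB; first exact: cvg_cst.
    by apply: cvgM; [exact: cvg_cst|exact: cvg_id].
  - by apply: continuous_subspaceT => t; exact: cvg_cst.
have [c cT maxG] := EVT_max T0 cG.
have Gc : 0 < y c - b c.
  by rewrite (lt_le_trans _ (maxG T _)) ?subr_gt0// in_itv/= T0 lexx.
(* The excess is nonpositive at 0, where the bound is at least [y 0], so the maximum is interior on
   the left. *)
have c0 : 0 < c.
  move: cT; rewrite in_itv/= => /andP[]; rewrite le_eqVlt => /predU1P[c0|//].
  by move: Gc; rewrite -c0 /b mulr0 subr0 subr_gt0 gt_max !ltxx.
have dc : d < y c.
  by move: Gc; rewrite subr_gt0; apply: le_lt_trans; rewrite le_max lexx orbT.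
(* [yi] is the function attaining the maximum at [c]. It stays below [y] and touches it at [c], so a
   lower bound for [yi] before [c] is one for [y]. *)
have [dy [yi [yiy yic] [Hdy dyk]]] :
    exists dy, exists2 yi : R -> R, (forall s, yi s <= y s) /\ yi c = y c &
      is_derive c (1 : R) yi dy /\ dy < - k.
  have [y12|/ltW y21] := leP (y1 c) (y2 c).
    have yc : y c = y2 c by rewrite /y max_r.
    rewrite yc in dc; have [dy ? ?] := dy2 c c0 dc y12.
    by exists dy, y2 => //; split => // s; rewrite le_max lexx orbT.
  have yc : y c = y1 c by rewrite /y max_l.
  rewrite yc in dc; have [dy ? ?] := dy1 c c0 dc y21.
  by exists dy, y1 => //; split => // s; rewrite le_max lexx.
have : \forall s \near c^'-, False; last by move/filter_ex => [].
have := is_derive_lt_left Hdy dyk; rewrite yic => Hn.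
near=> s.
have sc : s < c by near: s; exact: nbhs_left_lt.
have s0 : 0 < s by near: s; exact: nbhs_left_gt.
have : y c + k * (c - s) < yi s by near: s.
have := yiy s.
(* Going back in time the bound rises at rate at most [k], whereas [yi] rises faster; the excess at
   [s] would then beat its maximum. *)
have : b s <= b c + k * (c - s).
  rewrite /b ge_max; apply/andP; split.
    apply: (@le_trans _ _ (y 0 - k * c + k * (c - s))).
      by rewrite le_eqVlt; apply/orP; left; apply/eqP; ring.
    by rewrite lerD2r le_max lexx.
  rewrite -[leLHS]addr0 lerD ?le_max ?lexx ?orbT// mulr_ge0// subr_ge0 ltW//.
have := maxG s; rewrite in_itv/= (ltW s0)/= (le_trans (ltW sc)); last first.
  by move: cT; rewrite in_itv/= => /andP[].
by move=> /(_ isT); lra.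
Unshelve. all: by end_near. Qed.

(* The library's [x `^ a] is 1 for [x < 0], hence discontinuous at 0; [ppow a] is continuous. *)
Definition ppow (a x : R) : R := Num.max 0 x `^ a.

Lemma ppow_id (a x : R) : 0 <= x -> ppow a x = x `^ a.
Proof. by move=> x0; rewrite /ppow max_r. Qed.

Lemma ppow_ge0 a x : 0 <= ppow a x.
Proof. exact: powR_ge0. Qed.

Lemma ppow0 (a : R) : a != 0 -> ppow a 0 = 0.
Proof. by move=> a0; rewrite /ppow maxxx powR0. Qed.

Lemma ler_ppow (a x y : R) : 0 <= a -> x <= y -> ppow a x <= ppow a y.
Proof.
move=> a0 xy; apply: ge0_ler_powR; rewrite ?nnegrE// ?ge_max !le_max !lexx//.
by rewrite xy orbT.
Qed.

(** Locally zero on the left of 0 and a differentiable power on the right; at 0 the radius for [e]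
    is [e] to the power [1 / a]. *)
Lemma continuous_ppow (a : R) : 0 < a -> continuous (ppow a).
Proof.
move=> a0; suff H (x : R) : ppow a z @[z --> x] --> ppow a x by move=> x; exact: H.
have [x0|x0|->] := ltgtP x 0.
- apply: (@cvg_trans _ (cst (0 : R) @ x)).
    apply: near_eq_cvg; near=> z.
    rewrite /ppow max_l ?powR0 ?gt_eqF//.
    by apply/ltW; near: z; exact: lt_nbhsl.
  have -> : ppow a x = 0 by rewrite /ppow max_l ?ltW// powR0 ?gt_eqF.
  exact: (@cst_continuous R R 0 x).
- apply: (@cvg_trans _ ((fun z : R => z `^ a) @ x)).
    apply: near_eq_cvg; near=> z; rewrite ppow_id//.
    by apply/ltW; near: z; exact: lt_nbhsr.
  rewrite ppow_id ?ltW//.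
  suff : {for x, continuous (fun z : R => z `^ a)} by [].
  apply: differentiable_continuous; apply/derivable1_diffP; apply: derivable_powR.
  by rewrite in_itv/= andbT.
- rewrite ppow0 ?gt_eqF//.
  apply/cvgrPdist_lt => e e0.
  exists (e `^ a^-1) => /=; first exact: powR_gt0.
  move=> z /=; rewrite !sub0r !normrN => ze.
  rewrite ger0_norm ?ppow_ge0//.
  have -> : e = (e `^ a^-1) `^ a by rewrite -powRrM mulVf ?powRr1 ?gt_eqF ?ltW.
  apply: gt0_ltr_powR => //; rewrite ?nnegrE ?le_max ?lexx ?powR_ge0//.
  by rewrite gt_max powR_gt0//= (le_lt_trans _ ze)// ler_norm.
Unshelve. all: by end_near. Qed.

End ScalarComparison.

(** * The arctangent substitution and the fixed-time bound it yields *)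

Section FixedTimeBound.
Variable R : realType.
Set Implicit Arguments.
Unset Strict Implicit.
Unset Printing Implicit Defensive.

(** For [s <= 1] the smaller exponent gives the larger power, for [s > 1] the larger exponent
    does. *)
Lemma powR_le_mix (s e1 e e2 : R) :
  0 < s -> e1 <= e -> e <= e2 -> s `^ e <= s `^ e1 + s `^ e2.
Proof.
move=> s0 e1e ee2; have [s1|s1] := leP s 1.
  apply: ler_wpDr; first exact: powR_ge0.
  by apply: ger_powR => //; rewrite s0.
apply: ler_wpDl; first exact: powR_ge0.
by apply: ler_powR => //; exact: ltW.
Qed.

Lemma is_derive_near_eq (f g : R -> R) (t d : R) :
  {near t, f =1 g} -> is_derive t (1 : R) f d -> is_derive t (1 : R) g d.
Proof.
move=> fg [df <-]; split; first exact: near_eq_derivable df.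
by symmetry; exact: near_eq_derive.
Qed.

(** The derivative is [eta S^(eta - 1) S' / (1 + S^(2 eta))]. As [S^(1 - eta) + S^(1 + eta) = S^(1 -
    eta) (1 + S^(2 eta))], the denominator cancels and every power of [S] disappears. *)
Lemma is_derive_atan_ppow (S : R -> R) (t dS eta kappa : R) :
  is_derive t (1 : R) S dS -> 0 < S t -> 0 < eta ->
  dS <= - (kappa * (S t `^ (1 - eta) + S t `^ (1 + eta))) ->
  exists2 dy, is_derive t (1 : R) (fun s => atan (ppow eta (S s))) dy &
    dy <= - (kappa * eta).
Proof.
move=> HS S0 eta0 dSle.
exists ((1 + (S t `^ eta) ^+ 2)^-1 * (eta * S t `^ (eta - 1) * dS)).
  apply: (@is_derive_near_eq (fun s => atan (S s `^ eta))) => [|].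
    near=> s => /=; rewrite ppow_id//; apply: ltW; near: s.
    have cS : {for t, continuous S}.
      by apply/differentiable_continuous/derivable1_diffP; case: HS.
    exact: (cvgr_gt (S t) cS).
  have := is_derive1_powR eta S0 => HP.
  have H1 := is_derive1_comp HP HS.
  exact: is_derive1_comp.
set X := S t `^ eta.
have X0 : 0 < X by exact: powR_gt0.
have E1 : S t `^ (eta - 1) * S t `^ (1 - eta) = 1.
  rewrite -powRD; last by rewrite (gt_eqF S0) implybT.
  by rewrite (_ : _ + _ = 0) ?powRr0//; ring.
have E2 : S t `^ (1 + eta) = S t `^ (1 - eta) * X ^+ 2.
  rewrite expr2 /X -!powRD; try by rewrite (gt_eqF S0) implybT.
  by congr powR; ring.
have P0 : 0 < S t `^ (eta - 1) by exact: powR_gt0.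
rewrite ler_pdivrMl; last by nra.
apply: (@le_trans _ _ (eta * S t `^ (eta - 1) *
    - (kappa * (S t `^ (1 - eta) + S t `^ (1 + eta))))).
  by rewrite ler_pM2l// mulr_gt0.
rewrite E2 le_eqVlt; apply/orP; left; apply/eqP.
transitivity (- (eta * kappa * (S t `^ (eta - 1) * S t `^ (1 - eta)) * (1 + X ^+ 2))).
  by ring.
by rewrite E1; ring.
Unshelve. all: by end_near. Qed.

Variables (c C eta k : R).
Hypotheses (c0 : 0 < c) (C0 : 0 < C) (eta0 : 0 < eta) (k0 : 0 < k).

(** The substituted variable, decreasing at rate [k] and stopped at 0. Clamping negative times keeps
    it below [pi / 2] everywhere, so that [tan] is continuous along it on the whole plane. *)
Definition fxt_arg (r t : R) : R :=
  Num.max 0 (atan (ppow eta ((C * r) ^+ 2)) - k * Num.max 0 t).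

(** Tangent, power [1 / eta] and square root invert the substitution; [C] scales the initial error
    and [c] the result. *)
Definition fxt_bound (r t : R) : R :=
  c * Num.sqrt (ppow eta^-1 (tan (fxt_arg r t))).

Lemma fxt_arg_itv r t : fxt_arg r t \in `](- (pi / 2)), (pi / 2)[.
Proof.
have pi0 := pi_gt0 R.
rewrite in_itv/= /fxt_arg; apply/andP; split.
  by rewrite lt_max; apply/orP; left; lra.
rewrite gt_max; apply/andP; split; first by lra.
apply: le_lt_trans (atan_ltpi2 (ppow eta ((C * r) ^+ 2))).
by rewrite gerBl mulr_ge0 ?(ltW k0)// le_max lexx.
Qed.

Lemma ler_tan_itv : {in `](- (pi / 2)), (pi / 2)[ &, {mono (@tan R) : x y / x <= y}}.
Proof. by move=> x y xI yI; rewrite leNgt ltr_tan// -leNgt. Qed.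

Lemma atan_ppow_ge0 x : 0 <= atan (ppow eta x).
Proof. by rewrite -(@atan0 R); apply: le_atan; exact: ppow_ge0. Qed.

(** The substitution and its inverse cancel at time 0, so the bound is linear in [r] there, hence of
    class K. *)
Lemma fxt_bound0 r : 0 <= r -> fxt_bound r 0 = c * C * r.
Proof.
move=> r0; rewrite /fxt_bound /fxt_arg maxxx mulr0 subr0 max_r ?atan_ppow_ge0//.
rewrite atanK (ppow_id _ (ppow_ge0 _ _)) ppow_id ?sqr_ge0// -powRrM mulfV ?gt_eqF//.
by rewrite powRr1 ?sqr_ge0// sqrtr_sqr ger0_norm ?mulrA// mulr_ge0// ltW.
Qed.

Lemma continuous_fxt_bound :
  continuous (fun z : R * R => fxt_bound z.1 z.2).
Proof.
have cmax (g : R * R -> R) : continuous g -> continuous (fun z => Num.max 0 (g z)).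
  move=> cg z; apply: (@continuous_max R _ (fun=> 0) g z) => //; last exact: cg.
  exact: cvg_cst.
have carg : continuous (fun z : R * R => fxt_arg z.1 z.2).
  apply: (cmax _) => z; apply: cvgB.
    apply: (@continuous_comp _ _ _ (fun z : R * R => ppow eta ((C * z.1) ^+ 2)) atan);
      last exact: continuous_atan.
    apply: (@continuous_comp _ _ _ (fun z : R * R => (C * z.1) ^+ 2) (ppow eta));
      last exact: continuous_ppow.
    by apply: cvgM; (apply: cvgM; [exact: cvg_cst | exact: cvg_fst]).
  apply: cvgM; first exact: cvg_cst.
  by apply: (cmax (fun z : R * R => z.2)) => {}z; exact: cvg_snd.
move=> z; apply: cvgM; first exact: cvg_cst.
apply: (@continuous_comp _ _ _ (fun z : R * R => ppow eta^-1 (tan (fxt_arg z.1 z.2))) Num.sqrt);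
  last exact: sqrt_continuous.
apply: (@continuous_comp _ _ _ (fun z : R * R => tan (fxt_arg z.1 z.2)) (ppow eta^-1));
  last by apply: continuous_ppow; rewrite invr_gt0.
apply: (@continuous_comp _ _ _ (fun z : R * R => fxt_arg z.1 z.2) tan); first exact: carg.
apply: continuous_tan; apply: lt0r_neq0; apply: cos_gt0_pihalf.
by have := fxt_arg_itv z.1 z.2; rewrite in_itv.
Qed.

Lemma fxt_bound_ge0 r t : 0 <= fxt_bound r t.
Proof. by rewrite mulr_ge0 ?sqrtr_ge0// ltW. Qed.

Lemma classKLFxT_fxt_bound : classKLFxT fxt_bound.
Proof.
have cr r : continuous (fxt_bound r).
  move=> t; apply: (@continuous_comp _ _ _ (fun t : R => (r, t))
    (fun z : R * R => fxt_bound z.1 z.2)); last exact: continuous_fxt_bound.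
  by apply: (@cvg_pair _ _ _ _ (nbhs r) (nbhs t)); [exact: cvg_cst|exact: cvg_id].
have ct t : continuous (fxt_bound ^~ t).
  move=> r; apply: (@continuous_comp _ _ _ (fun r : R => (r, t))
    (fun z : R * R => fxt_bound z.1 z.2)); last exact: continuous_fxt_bound.
  by apply: (@cvg_pair _ _ _ _ (nbhs r) (nbhs t)); [exact: cvg_id|exact: cvg_cst].
split; first by apply: continuous_subspaceT; exact: continuous_fxt_bound.
split; first by move=> *; exact: fxt_bound_ge0.
split.
  split; first by apply: continuous_subspaceT; exact: ct.
  split; first by rewrite fxt_bound0// mulr0.
  split; first by move=> *; exact: fxt_bound_ge0.
  move=> r s r0 rs; rewrite !fxt_bound0//; last by rewrite (le_trans r0)// ltW.
  by rewrite ltr_pM2l// mulr_gt0.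
split; first by move=> r _; apply: continuous_subspaceT; exact: cr.
split.
  move=> r t s r0 t0 ts; rewrite ler_pM2l// ler_wsqrtr// ler_ppow//.
    by rewrite invr_ge0 ltW.
  rewrite ler_tan_itv ?fxt_arg_itv// /fxt_arg ge_max !le_max lexx/=.
  apply/orP; right; rewrite lerD2l lerN2 ler_pM2l// ge_max !le_max lexx/=.
  by rewrite ts orbT.
(* The settling time is the moment when [fxt_arg] reaches 0; it stays below [pi / 2 / k] because
   [atan] stays below [pi / 2]. *)
exists (fun r => atan (ppow eta ((C * r) ^+ 2)) / k); split.
  apply: continuous_subspaceT => r; apply: cvgM; last exact: cvg_cst.
  apply: (@continuous_comp _ _ _ (fun z : R => ppow eta ((C * z) ^+ 2)) atan);
      last exact: continuous_atan.
  apply: (@continuous_comp _ _ _ (fun z : R => (C * z) ^+ 2) (ppow eta));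
      last exact: continuous_ppow.
  by apply: cvgM; (apply: cvgM; [exact: cvg_cst | exact: cvg_id]).
split; first by move=> r _; rewrite divr_ge0 ?atan_ppow_ge0// ltW.
split.
  by exists (pi / 2 / k) => r _; rewrite ler_pM2r ?invr_gt0// ltW// atan_ltpi2.
split; first by rewrite mulr0 expr0n/= ppow0 ?gt_eqF// atan0 mul0r.
move=> r t r0 t0; rewrite ler_pdivrMr// => H.
rewrite /fxt_bound (_ : fxt_arg r t = 0).
  by rewrite tan0 ppow0 ?sqrtr0 ?mulr0// gt_eqF// invr_gt0.
by rewrite /fxt_arg (max_r t0) max_l// subr_le0 [k * t]mulrC.
Qed.

(* Inverts the change of variable [s |-> atan (s ^+ 2 `^ eta)]. *)
Lemma le_fxt_bound (s r t D : R) : 0 <= s -> 0 <= r -> 0 <= t -> 0 <= D ->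
  atan (ppow eta (s ^+ 2)) <=
    Num.max (atan (ppow eta ((C * r) ^+ 2)) - k * t) (atan (ppow eta (D ^+ 2))) ->
  c * s <= fxt_bound r t + c * D.
Proof.
move=> s0 r0 t0 D0.
have ppowK x : 0 <= x -> ppow eta^-1 (ppow eta x) = x.
  move=> x0; rewrite (ppow_id _ (ppow_ge0 _ _)) ppow_id// -powRrM mulfV ?gt_eqF//.
  by rewrite powRr1.
have ei : 0 <= eta^-1 by rewrite invr_ge0 ltW.
have fin x : 0 <= x -> s ^+ 2 <= x -> s <= Num.sqrt x.
  by move=> x0 sx; rewrite -(ger0_norm s0) -sqrtr_sqr ler_wsqrtr.
(* Either the decreasing branch dominates and is inverted into [fxt_bound], or the threshold does
   and monotonicity gives [s <= D]. *)
rewrite le_max => /orP[H|H].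
  apply: (@le_trans _ _ (fxt_bound r t)); last by rewrite lerDl mulr_ge0// ltW.
  rewrite ler_pM2l//; apply: fin; first exact: ppow_ge0.
  rewrite -[leLHS]ppowK ?sqr_ge0//; apply: ler_ppow => //.
  rewrite -[leLHS]atanK ler_tan_itv ?fxt_arg_itv//.
    by rewrite /fxt_arg le_max (max_r t0) H orbT.
  by rewrite in_itv/= atan_gtNpi2 atan_ltpi2.
apply: ler_wpDl; first exact: fxt_bound_ge0.
rewrite ler_pM2l// -ler_sqr ?nnegrE//.
rewrite -(ppowK _ (sqr_ge0 s)) -(ppowK _ (sqr_ge0 D)); apply: ler_ppow => //.
by rewrite -[leLHS]atanK -[leRHS]atanK ler_tan_itv// in_itv/= atan_gtNpi2 atan_ltpi2.
Qed.

End FixedTimeBound.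

(** * Differentiation along curves, gradients and Jacobians *)

Section Calculus.
Variable R : realType.
Set Implicit Arguments.
Unset Strict Implicit.
Unset Printing Implicit Defensive.

Lemma is_derive_coord (V : normedModType R) k (z : V -> 'rV[R]_k) (t v : V) (w : 'rV[R]_k) i :
  is_derive t v z w -> is_derive t v (fun s => z s 0 i) (w 0 i).
Proof.
move=> [dz <-]; split; first by move/derivable_mxP: dz; exact.
by rewrite derive_mx// mxE.
Qed.

Lemma is_derive_dot k (z : R -> 'rV[R]_k) (t : R) (w : 'rV[R]_k) :
  is_derive t (1 : R) z w ->
  is_derive t (1 : R) (fun s => dot (z s) (z s)) (2 * dot (z t) w).
Proof.
move=> dz.
have H (i : 'I_k) : is_derive t (1 : R) (fun s => z s 0 i * z s 0 i) (2 * (z t 0 i * w 0 i)).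
  have dzi := is_derive_coord i dz.
  by apply: is_derive_eq; rewrite /GRing.scale/=; ring.
have := is_derive_sum H; rewrite -mulr_sumr -dotE.
congr is_derive; apply/funext => s.
by rewrite dotE fct_sumE.
Qed.

Lemma continuous_sum (T : topologicalType) (W : normedModType R) (I : finType)
    (F : I -> T -> W) :
  (forall i, continuous (F i)) -> continuous (fun z => \sum_i F i z).
Proof.
move=> cF; rewrite -fct_sumE.
apply: (big_ind (fun g : T -> W => continuous g)) => //.
- exact: cst_continuous.
- by move=> f g cf cg z; apply: cvgD; [exact: cf|exact: cg].
Qed.

Lemma continuous_mulmxr k l (A : 'M[R]_(k, l)) :
  continuous (mulmxr A : 'rV_k -> 'rV_l).
Proof.
have H : continuous (fun v : 'rV[R]_k => \sum_i v 0 i *: row i A).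
  apply: (@continuous_sum 'rV[R]_k 'rV[R]_l) => i v.
  by apply: continuousZr_tmp; exact: coord_continuous.
rewrite (_ : (mulmxr A : 'rV_k -> 'rV_l) = fun v : 'rV_k => \sum_i v 0 i *: row i A).
  exact: H.
by apply/funext => v; rewrite -mulmx_sum_row.
Qed.

Lemma is_diff_mulmxr k l (A : 'M[R]_(k, l)) (z : 'rV_k) :
  is_diff z (mulmxr A : 'rV_k -> 'rV_l) (mulmxr A : 'rV_k -> 'rV_l).
Proof.
apply: DiffDef; first exact/linear_differentiable/continuous_mulmxr.
by rewrite diff_lin//; exact: continuous_mulmxr.
Qed.

Lemma continuous_dot k : continuous (fun z : 'rV[R]_k => dot z z).
Proof.
rewrite (_ : (fun z => _) = fun z : 'rV[R]_k => \sum_i z 0 i * z 0 i); last first.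
  by apply/funext => s; rewrite dotE.
by apply: (@continuous_sum 'rV[R]_k R) => i z; apply: continuousM; exact: coord_continuous.
Qed.

Lemma diff_row_sum (W : normedModType R) k (F : 'rV[R]_k -> W) z v :
  differentiable F z -> 'd F z v = \sum_j v 0 j *: 'D_(delta_mx 0 j) F z.
Proof.
move=> dF; rewrite [v in LHS]row_sum_delta linear_sum/=.
by apply: eq_bigr => j _; rewrite linearZ/= deriveE.
Qed.

Lemma diff_grad k (F : 'rV[R]_k -> R) z v :
  differentiable F z -> 'd F z v = dot (grad F z) v.
Proof.
move=> dF; rewrite diff_row_sum// dotE; apply: eq_bigr => j _.
by rewrite mxE mulrC.
Qed.

Lemma diff_jacobian a b (g : 'rV[R]_a -> 'rV[R]_b) z v :
  differentiable g z -> 'd g z v = v *m (Defs.jacobian g z)^T.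
Proof.
move=> dg; rewrite diff_row_sum//; apply/rowP => i.
rewrite summxE mxE; apply: eq_bigr => j _.
by rewrite !mxE.
Qed.

Lemma is_derive_comp_jacobian a b (g : 'rV[R]_a -> 'rV[R]_b) (z : R -> 'rV[R]_a) t w :
  differentiable g (z t) -> is_derive t (1 : R) z w ->
  is_derive t (1 : R) (fun s => g (z s)) (w *m (Defs.jacobian g (z t))^T).
Proof.
move=> dg [dz <-].
have dz' : differentiable z t by apply/derivable1_diffP.
have dgz : differentiable (g \o z) t by exact: differentiable_comp.
split; first by apply/derivable1_diffP.
by rewrite -[fun s => _]/(g \o z) deriveE// diff_comp//= deriveE// -diff_jacobian.
Qed.

(** The Jacobian is continuous, so its entries are bounded on a compact set; the factors [a] and [b]
    pass from entries to Euclidean norms. *)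
Lemma jacobian_bounded a b (g : 'rV[R]_a -> 'rV[R]_b) (A : set 'rV[R]_a) :
  C1v g -> compact A ->
  exists2 C : R, 0 <= C & forall z v, A z -> enorm (v *m (Defs.jacobian g z)^T) <= C * enorm v.
Proof.
move=> [_ cJ] cA.
have /compact_bounded [M [Mr HM]] : compact (Defs.jacobian g @` A).
  by apply: continuous_compact => //; exact: continuous_subspaceT.
(* [HM] bounds the norm by any number strictly above [M], hence the shift by 1. *)
pose B := Num.max 0 (M + 1).
have B0 : 0 <= B by rewrite le_max lexx.
exists (b%:R * (a%:R * B)); first by rewrite !mulr_ge0.
move=> z v Az.
have JB i j : `|Defs.jacobian g z i j| <= B.
  apply: (@le_trans _ _ `|Defs.jacobian g z|).
    by rewrite [leRHS]/Num.Def.normr/= mx_normrE (le_bigmax _ _ (i, j)).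
  apply: (HM B); first by rewrite lt_max ltrDl ltr01 orbT.
  by exists z.
rewrite -mulrA; apply: enorm_le_coord => [|i]; first by rewrite !mulr_ge0// enorm_ge0.
rewrite mxE; apply: le_trans (ler_norm_sum _ _ _) _.
apply: (@le_trans _ _ (\sum_(j < a) B * enorm v)).
  apply: ler_sum => j _; rewrite mxE normrM mulrC ler_pM//.
  exact: coord_le_enorm.
by rewrite sumr_const card_ord -[_ *+ a]mulr_natl mulrA.
Qed.

(** Chain rule along [u |-> (h u, u)]; the right-hand side is [Gmap] at a steady state [x = h u]. *)
Lemma grad_comp_row_mx n N (F : 'rV[R]_(n + N) -> R) (h : 'rV[R]_N -> 'rV[R]_n) u :
  differentiable F (row_mx (h u) u) -> differentiable h u ->
  grad (fun v => F (row_mx (h v) v)) u =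
  lsubmx (grad F (row_mx (h u) u)) *m Defs.jacobian h u
  + rsubmx (grad F (row_mx (h u) u)).
Proof.
move=> dF dh; set G := grad F _.
pose r v := row_mx (h v) v.
(* Block matrices turn the pairing into a sum of linear images, to which the differentiation rules
   apply. *)
have rE : r = fun v => h v *m row_mx 1%:M 0 + v *m row_mx 0 1%:M.
  apply/funext => v; rewrite /r !mul_mx_row !mulmx1 !mulmx0 add_row_mx addr0 add0r//.
have dr : is_diff u r (mulmxr (row_mx 1%:M 0) \o 'd h u + mulmxr (row_mx 0 1%:M)).
  have dh' : is_diff u h ('d h u) by apply: DiffDef.
  rewrite rE; apply: is_diffD; last exact: is_diff_mulmxr.
  have H1 := is_diff_mulmxr (row_mx 1%:M 0 : 'M[R]_(n, n + N)) (h u). exact: (is_diff_comp dh' H1).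
have drv v : 'd r u v = row_mx ('d h u v) v.
  rewrite (diff_val (df := _ + _)) /=.
  rewrite -[LHS]/('d h u v *m row_mx 1%:M 0 + v *m row_mx 0 1%:M).
  by rewrite !mul_mx_row !mulmx1 !mulmx0 add_row_mx addr0 add0r.
have {}dr : differentiable r u by case: dr.
apply/rowP => i; rewrite [LHS]mxE [RHS]mxE.
rewrite -[fun v => _]/(F \o r) deriveE; last exact: differentiable_comp.
rewrite diff_comp//= diff_grad// -/G drv.
rewrite /dot -[X in X *m _]hsubmxK tr_row_mx mul_row_col mxE; congr (_ + _).
  rewrite [LHS]mxE [RHS]mxE; apply: eq_bigr => j _.
  by rewrite [X in _ * X = _]mxE [X in _ = _ * X]mxE deriveE.
rewrite mxE (bigD1 i)//= big1 => [|j ji]; first by rewrite !mxE !eqxx mulr1 addr0.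
by rewrite !mxE (negPf ji) andbF mulr0.
Qed.

End Calculus.

(** * Decay of the larger of two norms, and estimates on powers *)

Section Estimates.
Variable R : realType.
Set Implicit Arguments.
Unset Strict Implicit.
Unset Printing Implicit Defensive.

Lemma within_continuous_compT (T U W : topologicalType) (A : set T) (f : T -> U) (g : U -> W) :
  {within A, continuous f} -> continuous g -> {within A, continuous (fun s => g (f s))}.
Proof. by move=> cf cg s; exact: (continuous_comp (cf s) (cg _)). Qed.

(** The substitution is strictly increasing in the norm, so comparisons of substituted values carry
    back to norms and [max_decay] applies. Halving the rate makes the derivative bound strict. *)
Lemma max_norm_decay n N (z1 : R -> 'rV[R]_n) (z2 : R -> 'rV[R]_N) (kappa eta D : R) :
  0 < kappa -> 0 < eta -> 0 <= D ->
  {within `[0, +oo[, continuous z1} -> {within `[0, +oo[, continuous z2} ->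
  (forall t, 0 < t -> D < enorm (z1 t) -> enorm (z2 t) <= enorm (z1 t) ->
     exists2 w, is_derive t (1 : R) z1 w &
       2 * dot (z1 t) w <= - (kappa * ((enorm (z1 t) ^+ 2) `^ (1 - eta)
                                      + (enorm (z1 t) ^+ 2) `^ (1 + eta)))) ->
  (forall t, 0 < t -> D < enorm (z2 t) -> enorm (z1 t) <= enorm (z2 t) ->
     exists2 w, is_derive t (1 : R) z2 w &
       2 * dot (z2 t) w <= - (kappa * ((enorm (z2 t) ^+ 2) `^ (1 - eta)
                                      + (enorm (z2 t) ^+ 2) `^ (1 + eta)))) ->
  forall t, 0 <= t ->
    Num.max (atan (ppow eta (enorm (z1 t) ^+ 2))) (atan (ppow eta (enorm (z2 t) ^+ 2)))
    <= Num.max (Num.max (atan (ppow eta (enorm (z1 0) ^+ 2)))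
                        (atan (ppow eta (enorm (z2 0) ^+ 2))) - kappa * eta / 2 * t)
               (atan (ppow eta (D ^+ 2))).
Proof.
move=> kappa0 eta0 D0 cz1 cz2 dz1 dz2.
have lt_inv (s : R) : 0 <= s -> atan (ppow eta (D ^+ 2)) < atan (ppow eta (s ^+ 2)) -> D < s.
  move=> s0; rewrite !ltNge; apply: contra => sD.
  by apply: le_atan; apply: ler_ppow; rewrite ?(ltW eta0)// ler_sqr ?nnegrE.
have le_inv (s r : R) : 0 <= s -> 0 <= r ->
    atan (ppow eta (s ^+ 2)) <= atan (ppow eta (r ^+ 2)) -> s <= r.
  move=> s0 r0; rewrite !leNgt; apply: contra => rs; apply: lt_atan.
  rewrite !ppow_id ?sqr_ge0//; apply: gt0_ltr_powR; rewrite ?nnegrE ?sqr_ge0//.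
  by rewrite ltr_sqr ?nnegrE.
(* The scalar product is differentiable everywhere, unlike the norm at 0. *)
have ySE k (z : R -> 'rV[R]_k) : (fun s => atan (ppow eta (enorm (z s) ^+ 2))) =
    fun s => atan (ppow eta (dot (z s) (z s))).
  by apply/funext => s; rewrite enorm_sqr.
have cy k (z : R -> 'rV[R]_k) : {within `[0, +oo[, continuous z} ->
    {within `[0, +oo[, continuous (fun s => atan (ppow eta (enorm (z s) ^+ 2)))}.
  move=> cz; rewrite ySE.
  apply: (within_continuous_compT cz (g := fun v => atan (ppow eta (dot v v)))) => v.
  apply: (@continuous_comp _ _ _ (fun v : 'rV[R]_k => ppow eta (dot v v)) atan);
    last exact: continuous_atan.
  apply: (@continuous_comp _ _ _ (fun v : 'rV[R]_k => dot v v) (ppow eta));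
    last exact: continuous_ppow.
  exact: continuous_dot.
have dy k (z : R -> 'rV[R]_k) t w : 0 < enorm (z t) -> is_derive t (1 : R) z w ->
    2 * dot (z t) w <= - (kappa * ((enorm (z t) ^+ 2) `^ (1 - eta)
                                      + (enorm (z t) ^+ 2) `^ (1 + eta))) ->
    exists2 dy, is_derive t (1 : R) (fun s => atan (ppow eta (enorm (z s) ^+ 2))) dy
                & dy < - (kappa * eta / 2).
  move=> z0 zw; rewrite enorm_sqr => H.
  have [|dy dy1 dy2] := is_derive_atan_ppow (is_derive_dot zw) _ eta0 H.
    by rewrite -enorm_sqr exprn_gt0.
  exists dy; first by rewrite ySE.
  by apply: (le_lt_trans dy2); have := mulr_gt0 kappa0 eta0; lra.
apply: max_decay; [exact: cy|exact: cy| | |by rewrite divr_ge0 ?mulr_ge0 ?ltW].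
- move=> t t0 /(lt_inv _ (enorm_ge0 _)) zD /(le_inv _ _ (enorm_ge0 _) (enorm_ge0 _)) z12.
  have [w] := dz1 t t0 zD z12.
  by apply: dy; exact: le_lt_trans zD.
- move=> t t0 /(lt_inv _ (enorm_ge0 _)) zD /(le_inv _ _ (enorm_ge0 _) (enorm_ge0 _)) z12.
  have [w] := dz2 t t0 zD z12.
  by apply: dy; exact: le_lt_trans zD.
Qed.

(** Since [S <= S^p + S^q], the perturbation consumes at most half of the decay. The other half is
    split equally between the two new powers, each bounded by [S^p + S^q]. *)
Lemma absorb_perturbation (S kappa p q eta nu : R) :
  0 < S -> 0 < kappa -> 0 <= eta -> p <= 1 - eta -> 1 + eta <= q -> nu <= kappa / 2 * S ->
  - (kappa * (S `^ p + S `^ q)) + nu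
  <= - (kappa / 4 * (S `^ (1 - eta) + S `^ (1 + eta))).
Proof.
move=> S0 k0 eta0 pe eq nuS.
have H1 : S <= S `^ p + S `^ q.
  by rewrite -[leLHS]powRr1 ?(ltW S0)//; apply: powR_le_mix => //; lra.
have H2 : S `^ (1 - eta) <= S `^ p + S `^ q by apply: powR_le_mix => //; lra.
have H3 : S `^ (1 + eta) <= S `^ p + S `^ q by apply: powR_le_mix => //; lra.
by nra.
Qed.

(** The exponent [- xi1] is negative and calls for the upper bound on [enorm s]; [- xi2] is positive
    and calls for the lower bound [c * enorm e], which follows from Cauchy-Schwarz. *)
Lemma phixi_dot_ge N (xi1 xi2 c B : R) (s e : 'rV[R]_N) :
  0 < xi1 -> xi2 < 0 -> 0 < c -> 0 < enorm e ->
  c * enorm e ^+ 2 <= dot s e -> enorm s <= B * enorm e ->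
  c * enorm e ^+ 2 * ((B * enorm e) `^ (- xi1) + (c * enorm e) `^ (- xi2))
  <= dot (phixi xi1 xi2 s) e.
Proof.
move=> xi10 xi20 c0 e0 ce sB.
have ce0 : 0 < c * enorm e ^+ 2 by rewrite mulr_gt0// exprn_gt0.
have cs : c * enorm e <= enorm s.
  rewrite -(ler_pM2r e0) (le_trans _ (dot_le_enorm s e))// (le_trans _ ce)//.
  by rewrite -mulrA expr2.
have s0 : 0 < enorm s by apply: lt_le_trans cs; rewrite mulr_gt0.
have sn0 : s != 0 by apply: contraTneq s0 => ->; rewrite enorm0 ltxx.
rewrite /phixi (negPf sn0) dotDl !dotZl -mulrDl -!powRN mulrC.
apply: ler_pM; rewrite ?addr_ge0 ?powR_ge0 ?(ltW ce0)//.
apply: lerD.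
  rewrite !powRN lef_pV2 ?posrE ?powR_gt0 ?(lt_le_trans s0)//.
  by apply: ge0_ler_powR; rewrite ?nnegrE ?enorm_ge0 ?(ltW xi10)// (le_trans _ sB)// ltW.
by apply: ge0_ler_powR; rewrite ?nnegrE ?enorm_ge0// ?oppr_ge0 ?(ltW xi20)//
  mulr_ge0 ?enorm_ge0// ltW.
Qed.

(* [2 gamma^2 c V^2 ((B V)^-xi1 + (c V)^-xi2)] is a combination of the powers [1 - xi1 / 2] and
   [1 - xi2 / 2] of [S = (gamma V)^2]. *)
Lemma scaled_powers_ge (xi1 xi2 c B gamma : R) :
  0 < c -> 0 < B -> 0 < gamma ->
  exists2 kappa : R, 0 < kappa & forall V, 0 < V ->
    kappa * (((gamma * V) ^+ 2) `^ (1 - xi1 / 2) + ((gamma * V) ^+ 2) `^ (1 - xi2 / 2))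
    <= 2 * gamma ^+ 2 * (c * V ^+ 2 * ((B * V) `^ (- xi1) + (c * V) `^ (- xi2))).
Proof.
move=> c0 B0 g0.
have split_pow (A xi V : R) : 0 < A -> 0 < V ->
    2 * gamma ^+ 2 * (c * V ^+ 2 * (A * V) `^ (- xi)) =
    2 * c * (A / gamma) `^ (- xi) * ((gamma * V) ^+ 2) `^ (1 - xi / 2).
  move=> A0 V0; have gV0 : 0 < gamma * V by rewrite mulr_gt0.
  have -> : ((gamma * V) ^+ 2) `^ (1 - xi / 2) = (gamma * V) ^+ 2 * (gamma * V) `^ (- xi).
    rewrite -powR_mulrn ?(ltW gV0)// -powRrM -powRD; last by rewrite (gt_eqF gV0) implybT.
    by congr powR; field.
  have -> : A * V = (A / gamma) * (gamma * V) by field; rewrite gt_eqF.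
  rewrite powRM ?divr_ge0 ?(ltW A0) ?(ltW g0) ?(ltW gV0)//; ring.
pose k1 := 2 * c * (B / gamma) `^ (- xi1); pose k2 := 2 * c * (c / gamma) `^ (- xi2).
have k10 : 0 < k1 by rewrite !mulr_gt0// powR_gt0// divr_gt0.
have k20 : 0 < k2 by rewrite !mulr_gt0// powR_gt0// divr_gt0.
exists (Num.min k1 k2); first by rewrite lt_min k10.
move=> V V0; rewrite 2![in leRHS]mulrDr !split_pow// mulrDr.
by apply: lerD; rewrite ler_wpM2r ?powR_ge0// ge_min lexx ?orbT.
Qed.

End Estimates.

(** * Gradients of strongly convex functions, and a bound on compact sets *)

Section Descent.
Variable R : realType.
Set Implicit Arguments.
Unset Strict Implicit.
Unset Printing Implicit Defensive.

Section StronglyConvex.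
Variables (N : nat) (F : 'rV[R]_N -> R) (g : 'rV[R]_N -> 'rV[R]_N) (L mu : R).
Variable us : 'rV[R]_N.
Hypotheses (L0 : 0 < L) (mu0 : 0 < mu).
Hypothesis smooth : forall u uh, enorm (g uh - g u) <= L * enorm (uh - u).
Hypothesis convex : forall u uh,
  F u + dot (g u) (uh - u) + mu / 2 * enorm (uh - u) ^+ 2 <= F uh.
Hypothesis minF : forall u, F us <= F u.

(* No derivative is needed: [g u] makes a nonnegative angle with [u - us], which at
   [u = us - g us / 2L] is incompatible with the Lipschitz bound unless [g us = 0]. *)
Lemma gradient_min_eq0 : g us = 0.
Proof.
(* This step length turns the Lipschitz bound into [|g us - g u| <= |g us| / 2]. *)
pose tau : R := (2 * L)^-1; pose u := us - tau *: g us.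
have tau0 : 0 < tau by rewrite invr_gt0 mulr_gt0.
have := convex u us; have := minF u.
have -> : us - u = tau *: g us by rewrite /u opprB addrC subrK.
rewrite dotZr => H1 H2.
have H3 : dot (g u) (g us) <= 0.
  rewrite -(pmulr_rle0 _ tau0).
  have : 0 <= mu / 2 * enorm (tau *: g us) ^+ 2.
    by rewrite mulr_ge0 ?sqr_ge0 ?divr_ge0 ?ltW.
  by lra.
have H4 : dot (g us - g u) (g us) <= 2^-1 * enorm (g us) ^+ 2.
  apply: le_trans (dot_le_enorm _ _) _.
  rewrite expr2 mulrA ler_wpM2r ?enorm_ge0//.
  apply: le_trans (smooth _ _) _.
  have -> : us - u = tau *: g us by rewrite /u opprB addrC subrK.
  rewrite enormZ gtr0_norm// mulrA /tau ler_wpM2r ?enorm_ge0//.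
  by rewrite invfM mulrC -mulrA mulVf ?mulr1// gt_eqF.
apply: enorm_eq0; apply/eqP; rewrite -sqrf_eq0 eq_le sqr_ge0 andbT.
by move: H4; rewrite dotBl -enorm_sqr; lra.
Qed.

(** Sum of the strong convexity inequalities from [us] to [u] and from [u] to [us]; the values of
    [F] cancel. *)
Lemma gradient_dot_ge u : mu * enorm (u - us) ^+ 2 <= dot (g u) (u - us).
Proof.
have := convex u us; have := convex us u.
rewrite gradient_min_eq0 (_ : dot 0 _ = 0); last by rewrite /dot mul0mx mxE.
rewrite -(opprB u us) dotNr enormN; lra.
Qed.

Lemma gradient_le u : enorm (g u) <= L * enorm (u - us).
Proof. by have := smooth us u; rewrite gradient_min_eq0 subr0. Qed.

(* [s] is the gradient at [u] perturbed by a fast state off its steady state. *)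
Lemma perturbed_gradient (K r : R) (u s : 'rV[R]_N) :
  enorm (s - g u) <= K * r * enorm (u - us) ->
  (mu - K * r) * enorm (u - us) ^+ 2 <= dot s (u - us) /\
  enorm s <= (L + K * r) * enorm (u - us).
Proof.
move=> sg; split.
  have -> : s = g u + (s - g u) by rewrite addrC subrK.
  rewrite dotDl; have := gradient_dot_ge u.
  have := oppr_dot_le_enorm (s - g u) (u - us).
  have := ler_wpM2r (enorm_ge0 (u - us)) sg.
  by lra.
have -> : s = g u + (s - g u) by rewrite addrC subrK.
by rewrite (le_trans (ler_enormD _ _))// mulrDl lerD// gradient_le.
Qed.

End StronglyConvex.

Lemma Lipschitz_compact_bounded a b (F : 'rV[R]_a -> 'rV[R]_b) (A : set 'rV[R]_a) (l : R) :
  (forall s t, enorm (F s - F t) <= l * enorm (s - t)) -> compact A ->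
  exists B, forall s, A s -> enorm (F s) <= B.
Proof.
move=> lipF /compact_bounded[M [_ AM]].
pose B := `|M| + 1.
have B0 : 0 <= B by rewrite addr_ge0.
exists (`|l| * (a%:R * B) + enorm (F 0)) => s As.
rewrite -[X in enorm X](subrK (F 0)) (le_trans (ler_enormD _ _))// lerD2r.
rewrite (le_trans (lipF _ _))// subr0.
rewrite (@le_trans _ _ (`|l| * enorm s))// ?ler_wpM2r ?enorm_ge0 ?ler_norm//.
rewrite ler_wpM2l//; apply: enorm_le_coord => // i.
apply: (@le_trans _ _ `|s|).
  by rewrite [leRHS]/Num.Def.normr/= mx_normrE (le_bigmax _ _ (0, i)).
by apply: AM => //; rewrite /B (le_lt_trans (ler_norm M))// ltrDl.
Qed.

End Descent.

(** * Constants, decay in the two regions, and the closed-loop estimate *)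

Theorem theorem2 (R : realType) (m n N : nat)
  (f : 'rV[R]_n -> 'rV[R]_N -> 'rV[R]_n)
  (phi : 'rV[R]_m -> 'rV[R]_(n + N) -> R)
  (h : 'rV[R]_N -> 'rV[R]_n)
  (Pi : 'rV[R]_m -> 'rV[R]_m) (Theta : set 'rV[R]_m)
  (varphi : 'rV[R]_m -> 'rV[R]_N)
  (xi1 xi2 eps0 gamma ell L mu K : R) :
  continuous (fun z : 'rV[R]_n * 'rV[R]_N => f z.1 z.2) ->
  0 < xi1 < 1 -> xi2 < 0 -> 0 < eps0 ->
  (forall theta, C1s (phi theta)) ->
  (* (A1) *)
  C1v h -> 0 < gamma -> 0 < ell ->
  (forall u v, enorm (h u - h v) <= ell * enorm (u - v)) ->
  (forall u, f (h u) u = 0) ->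
  (exists a p q : R, 0 < a /\ 0 < p < 1 /\ 1 < q /\
     forall x u uh, enorm (x - h uh) >= gamma * enorm (u - uh) ->
       ((x - h uh) *m (f x u)^T) 0 0 <=
         - (a / 2) * enorm (x - h uh) `^ (2 * p)
         - (a / 2) * enorm (x - h uh) `^ (2 * q)) ->
  (* (A2) *)
  (exists LPi : R, forall t1 t2, enorm (Pi t1 - Pi t2) <= LPi * enorm (t1 - t2)) ->
  compact Theta ->
  fwd_invariant (fun th => eps0 *: Pi th) Theta ->
  (* (A3) *)
  (forall theta, C1s (fun u => phi theta (row_mx (h u) u))) ->
  0 < L -> 0 < mu ->
  (forall theta u uh,
     enorm (grad (fun v => phi theta (row_mx (h v) v)) uh
            - grad (fun v => phi theta (row_mx (h v) v)) u) <= L * enorm (uh - u)) ->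
  (forall theta u uh,
     phi theta (row_mx (h uh) uh) >=
       phi theta (row_mx (h u) u)
       + (grad (fun v => phi theta (row_mx (h v) v)) u *m (uh - u)^T) 0 0
       + mu / 2 * enorm (uh - u) ^+ 2) ->
  C1v varphi ->
  (forall theta u, phi theta (row_mx (h (varphi theta)) (varphi theta))
                   <= phi theta (row_mx (h u) u)) ->
  (* (A4) *)
  0 < K ->
  (forall theta x xh u,
     enorm (Gmap phi h theta xh u - Gmap phi h theta x u) <= K * enorm (xh - x)) ->
  mu > K * (ell + gamma) ->
  exists (beta : R -> R -> R) (rho : R -> R),
    classKLFxT beta /\ classK rho /\
    forall (x : R -> 'rV[R]_n) (u : R -> 'rV[R]_N) (theta : R -> 'rV[R]_m),
      Theta (theta 0) ->
      cl_solution f phi h xi1 xi2 eps0 Pi Theta x u theta ->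
      forall t, 0 <= t ->
        enorm (row_mx (x t - h (varphi (theta t))) (u t - varphi (theta t)))
        <= beta (enorm (row_mx (x 0 - h (varphi (theta 0))) (u 0 - varphi (theta 0)))) t
           + rho (sup [set enorm (eps0 *: Pi (theta s)) | s in `[0, +oo[%classic]).

Proof.
move=> _ /andP[xi10 xi11] xi20 eps0_gt0 C1phi C1h gamma0 ell0 lip_h _ A1 [LPi lipPi] cTheta _
  C1Phi L0 mu0 smooth convex C1varphi argmin K0 lipG muK.
have [a [p [q [a0 [/andP[p0 p1] [q1 A1x]]]]]] := A1.
have [Cv Cv0 varphi_bd] := jacobian_bounded C1varphi cTheta.
have cvarphi : continuous varphi.
  by move=> s; apply: differentiable_continuous; case: C1varphi.
(* [h] is differentiated only at the points [varphi (theta t)], so its Jacobian is bounded on this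
   image. *)
have cvT : compact (varphi @` Theta).
  by apply: continuous_compact => //; exact: continuous_subspaceT.
have [Ch Ch0 h_bd] := jacobian_bounded C1h cvT.
have ch : continuous h by move=> s; apply: differentiable_continuous; case: C1h.
(* Coercivity and growth constants from [perturbed_gradient] with [r = ell + gamma]. *)
pose c := mu - K * (ell + gamma); pose B := L + K * (ell + gamma).
have c0 : 0 < c by rewrite /c subr_gt0.
have B0 : 0 < B by rewrite addr_gt0// mulr_gt0// addr_gt0.
have [kap2 kap20 Hkap2] := scaled_powers_ge xi1 xi2 c0 B0 gamma0.
(* One [eta] for the exponents [p], [q] of the fast part and [1 - xi1 / 2], [1 - xi2 / 2] of the
   slow part. *)
pose eta := Num.min (Num.min (1 - p) (q - 1)) (Num.min (xi1 / 2) (- (xi2 / 2))).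
have eta0 : 0 < eta by rewrite !lt_min; apply/andP; split; apply/andP; split; lra.
have [eta1 eta2] : p <= 1 - eta /\ 1 + eta <= q.
  have : eta <= 1 - p by rewrite !ge_min lexx.
  have : eta <= q - 1 by rewrite !ge_min lexx orbT.
  by lra.
have [eta3 eta4] : 1 - xi1 / 2 <= 1 - eta /\ 1 + eta <= 1 - xi2 / 2.
  have : eta <= xi1 / 2 by rewrite !ge_min lexx !orbT.
  have : eta <= - (xi2 / 2) by rewrite !ge_min lexx !orbT.
  by lra.
(* The quarter is the loss in [absorb_perturbation]. *)
pose kap := Num.min a kap2 / 4.
have kap0 : 0 < kap by rewrite divr_gt0// lt_min a0.
have kap_a : kap <= a / 4 by rewrite ler_pM2r// ge_min lexx.
have kap_2 : kap <= kap2 / 4 by rewrite ler_pM2r// ge_min lexx orbT.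
have weaken (k' s : R) : kap <= k' ->
    - (k' * (s `^ (1 - eta) + s `^ (1 + eta))) <= - (kap * (s `^ (1 - eta) + s `^ (1 + eta))).
  by move=> kk; rewrite lerN2 ler_wpM2r// addr_ge0// powR_ge0.
(* Above [chi * d], the first summand makes the drift absorbable in the fast region and the second
   in the slow one. The 1 keeps [chi] positive even if [Cv] is 0, so that the gain is strictly
   increasing. *)
pose chi := 4 * (Ch * Cv) / a + 4 * gamma * Cv / kap2 + 1.
have chi1 : 4 * (Ch * Cv) / a <= chi.
  by rewrite /chi -addrA lerDl addr_ge0// divr_ge0 ?mulr_ge0// ltW.
have chi2 : 4 * gamma * Cv / kap2 <= chi.
  by rewrite /chi addrAC lerDr addr_ge0// divr_ge0 ?mulr_ge0// ltW.
have chi0 : 0 < chi.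
  by rewrite /chi ltr_wpDl// addr_ge0// divr_ge0 ?mulr_ge0// ltW.
(* [cE] bounds the full error by the larger of the norms of [z1] and [z2]; [CE] bounds these two
   norms by the full error. *)
pose cE := 1 + gamma^-1; pose CE := 1 + gamma.
have cE0 : 0 < cE by rewrite addr_gt0// invr_gt0.
have CE0 : 0 < CE by rewrite addr_gt0.
have k0 : 0 < kap * eta / 2 by rewrite divr_gt0// mulr_gt0.
exists (fxt_bound cE CE eta (kap * eta / 2)), (fun d => cE * chi * d).
split; first exact: classKLFxT_fxt_bound.
split.
  split; first by apply: continuous_subspaceT => d; apply: cvgM; [exact: cvg_cst|exact: cvg_id].
  split; first by rewrite mulr0.
  split; first by move=> r r0; rewrite !mulr_ge0// ltW.
  by move=> r s r0 rs; rewrite ltr_pM2l// mulr_gt0.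
move=> x u theta Theta0 [cx [cu [cth [sol inTheta]]]] T T0.
set d := sup _.
(* [sup] dominates its set only if that set is bounded above, which follows from the Lipschitz bound
   on [Pi] over the compact [Theta]. *)
have dE (t : R) : 0 <= t -> enorm (eps0 *: Pi (theta t)) <= d.
  move=> t0; apply: ub_le_sup; last by exists t => //=; rewrite in_itv/= t0.
  have [M MP] := Lipschitz_compact_bounded lipPi cTheta.
  exists (`|eps0| * M) => _ [s + <-]; rewrite /= in_itv/= andbT => s0.
  by rewrite enormZ ler_wpM2l// MP//; exact: inTheta.
have d0 : 0 <= d by apply: le_trans (dE 0 (lexx 0)); exact: enorm_ge0.
pose e (t : R) : 'rV[R]_N := u t - varphi (theta t).
pose z1 (t : R) : 'rV[R]_n := x t - h (varphi (theta t)).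
(* Scaling by [gamma] makes the comparison with [z1] coincide with the alternative in (A1). *)
pose z2 (t : R) : 'rV[R]_N := gamma *: e t.
have z2E t : enorm (z2 t) = gamma * enorm (e t) by rewrite enormZ gtr0_norm.
have cvth : {within `[0, +oo[, continuous (varphi \o theta)}.
  exact: within_continuous_compT cth cvarphi.
have ce : {within `[0, +oo[, continuous e} by exact: within_continuousB.
have cz1 : {within `[0, +oo[, continuous z1}.
  by apply: within_continuousB => //; exact: within_continuous_compT cvth ch.
have cz2 : {within `[0, +oo[, continuous z2}.
  by apply: (within_continuous_compT ce) => v; exact: scaler_continuous.
have dvth (t : R) : 0 < t -> exists2 w : 'rV[R]_N,
    is_derive t (1 : R) (fun s : R => varphi (theta s)) w & enorm w <= Cv * d.
  move=> t0; have [_ [_ dth]] := sol t t0; have [dv _] := C1varphi.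
  exists (eps0 *: Pi (theta t) *m (Defs.jacobian varphi (theta t))^T).
    exact: is_derive_comp_jacobian.
  apply: le_trans (varphi_bd _ _ (inTheta _ (ltW t0))) _.
  by rewrite ler_wpM2l// dE// ltW.
have fast (t : R) : 0 < t -> chi * d < enorm (z1 t) -> enorm (z2 t) <= enorm (z1 t) ->
    exists2 w : 'rV[R]_n, is_derive t (1 : R) z1 w &
      2 * dot (z1 t) w <= - (kap * ((enorm (z1 t) ^+ 2) `^ (1 - eta)
                                    + (enorm (z1 t) ^+ 2) `^ (1 + eta))).
  move=> t0 z1D z21; have [dx _] := sol t t0; have [w dw wd] := dvth t t0.
  have [dh _] := C1h.
  exists (f (x t) (u t) - w *m (Defs.jacobian h (varphi (theta t)))^T).
    apply: is_deriveB => //.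
    exact: (is_derive_comp_jacobian (g := h) (z := fun s => varphi (theta s))).
  have z1_gt0 : 0 < enorm (z1 t) by apply: le_lt_trans z1D; rewrite mulr_ge0// ltW.
  have wJ : enorm (w *m (Defs.jacobian h (varphi (theta t)))^T) <= Ch * Cv * d.
    apply: le_trans (h_bd _ _ _) _; last by rewrite -mulrA ler_wpM2l.
    by exists (theta t) => //; apply: inTheta; exact: ltW.
  have := A1x (x t) (u t) (varphi (theta t)).
  rewrite -/(z1 t) -/(e t) -z2E => /(_ z21); rewrite -/(dot (z1 t) (f (x t) (u t))).
  have pw r : enorm (z1 t) `^ (2 * r) = (enorm (z1 t) ^+ 2) `^ r.
    by rewrite powRrM powR_mulrn ?enorm_ge0.
  rewrite !pw => Hf.
  apply: le_trans (weaken _ _ kap_a).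
  apply: le_trans (absorb_perturbation (nu := 2 * (enorm (z1 t) * (Ch * Cv * d)))
    _ a0 (ltW eta0) eta1 eta2 _); last 2 first.
  - by rewrite exprn_gt0.
  - have : 4 * (Ch * Cv) / a * d <= enorm (z1 t).
      by apply: le_trans (ltW z1D); rewrite ler_wpM2r.
    rewrite mulrAC ler_pdivrMr// => H.
    have := ler_wpM2l (enorm_ge0 (z1 t)) H; rewrite expr2; clear; lra.
  rewrite dotBr.
  have := oppr_dot_le_enorm (z1 t) (w *m (Defs.jacobian h (varphi (theta t)))^T).
  move: Hf (ler_wpM2l (enorm_ge0 (z1 t)) wJ); clear; lra.
have slow (t : R) : 0 < t -> chi * d < enorm (z2 t) -> enorm (z1 t) <= enorm (z2 t) ->
    exists2 w : 'rV[R]_N, is_derive t (1 : R) z2 w &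
      2 * dot (z2 t) w <= - (kap * ((enorm (z2 t) ^+ 2) `^ (1 - eta)
                                    + (enorm (z2 t) ^+ 2) `^ (1 + eta))).
  move=> t0 z2D z12; have [_ [du _]] := sol t t0; have [w dw wd] := dvth t t0.
  set s := Gmap _ _ _ _ _ in du.
  exists (gamma *: (- phixi xi1 xi2 s - w)).
    by apply: is_deriveZ; exact: is_deriveB.
  have z2_gt0 : 0 < enorm (z2 t) by apply: le_lt_trans z2D; rewrite mulr_ge0// ltW.
  have e_gt0 : 0 < enorm (e t) by move: z2_gt0; rewrite z2E pmulr_rgt0.
  pose g := grad (fun v => phi (theta t) (row_mx (h v) v)).
  (* At a steady state [Gmap] is the gradient of the reduced cost, so (A4) measures the deviation of
     [s] from [g (u t)]. *)
  have Gg v : Gmap phi h (theta t) (h v) v = g v.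
    rewrite /g grad_comp_row_mx//; first by have [] := C1phi (theta t).
    by have [] := C1h.
  have sg : enorm (s - g (u t)) <= K * (ell + gamma) * enorm (e t).
    rewrite -Gg (le_trans (lipG _ _ _ _))// -mulrA ler_pM2l//.
    (* Passing through [h (varphi (theta t))] costs [gamma |e|] for [z1], by the choice of region,
       and [ell |e|] by the Lipschitz bound on [h]. *)
    have -> : x t - h (u t) = z1 t + (h (varphi (theta t)) - h (u t)).
      by rewrite /z1 addrA subrK.
    rewrite (le_trans (ler_enormD _ _))// mulrDl addrC lerD//.
      by rewrite (le_trans (lip_h _ _))// -(enormN (e t)) opprB.
    by rewrite -z2E.
  have [sdot sle] := perturbed_gradient L0 mu0 (smooth (theta t)) (convex (theta t))
    (argmin (theta t)) sg.
  have Hphi := phixi_dot_ge xi10 xi20 c0 e_gt0 sdot sle.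
  have := Hkap2 _ e_gt0; rewrite -z2E => Hk.
  apply: le_trans (weaken _ _ kap_2).
  apply: le_trans (absorb_perturbation (nu := 2 * gamma ^+ 2 * (enorm (e t) * (Cv * d)))
    _ kap20 (ltW eta0) eta3 eta4 _); last 2 first.
  - by rewrite exprn_gt0.
  - have : 4 * gamma * Cv / kap2 * d <= enorm (z2 t).
      by apply: le_trans (ltW z2D); rewrite ler_wpM2r.
    rewrite mulrAC ler_pdivrMr// z2E => H.
    have := ler_wpM2l (mulr_ge0 (ltW gamma0) (enorm_ge0 (e t))) H.
    by rewrite !expr2; clear; lra.
  rewrite dotZl dotZr dotBr dotNr.
  have H1 := oppr_dot_le_enorm (e t) w.
  have H2 := ler_wpM2l (enorm_ge0 (e t)) wd.
  rewrite dotC in Hphi.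
  have g2 : 0 <= 2 * gamma ^+ 2 by rewrite mulr_ge0// sqr_ge0.
  move: Hk (ler_wpM2l g2 (lerD Hphi (le_trans H1 H2))); clear; lra.
have D0 : 0 <= chi * d by rewrite mulr_ge0// ltW.
have := max_norm_decay kap0 eta0 D0 cz1 cz2 fast slow T0.
set E := enorm (row_mx _ _); set E0 := enorm (row_mx _ _).
have [z1E0 eE0] : enorm (z1 0) <= E0 /\ enorm (e 0) <= E0 by exact: enorm_le_row_mx.
have E00 : 0 <= E0 by exact: enorm_ge0.
have z1C : enorm (z1 0) <= CE * E0.
  by rewrite (le_trans z1E0)// mulrDl mul1r lerDl mulr_ge0// ltW.
have z2C : enorm (z2 0) <= CE * E0.
  by rewrite z2E mulrDl mul1r ler_wpDl// ler_pM2l.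
have CEE : 0 <= CE * E0 by rewrite mulr_ge0// ltW.
have init : Num.max (atan (ppow eta (enorm (z1 0) ^+ 2))) (atan (ppow eta (enorm (z2 0) ^+ 2)))
    <= atan (ppow eta ((CE * E0) ^+ 2)).
  by rewrite ge_max; apply/andP; split; apply: le_atan; apply: ler_ppow;
    rewrite ?(ltW eta0)// ler_sqr ?nnegrE ?enorm_ge0.
move=> decay.
(* To be applied to whichever of the two norms at time [T] is the larger. *)
have fin s : 0 <= s -> atan (ppow eta (s ^+ 2)) <=
    Num.max (atan (ppow eta (enorm (z1 T) ^+ 2))) (atan (ppow eta (enorm (z2 T) ^+ 2))) ->
    cE * s <= fxt_bound cE CE eta (kap * eta / 2) E0 T + cE * (chi * d).
  move=> s0 Hs; apply: le_fxt_bound => //; apply: le_trans Hs _.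
  apply: le_trans decay _.
  by rewrite ge_max !le_max lerD2r init lexx orbT.
have H1 := fin _ (enorm_ge0 (z1 T)); have H2 := fin _ (enorm_ge0 (z2 T)).
rewrite /= -[cE * chi * d]mulrA.
have EE : E <= enorm (z1 T) + gamma^-1 * enorm (z2 T).
  by rewrite z2E mulKf ?gt_eqF// enorm_row_mx_le.
have g10 : 0 < gamma^-1 by rewrite invr_gt0.
have [z12|z21] := leP (enorm (z1 T)) (enorm (z2 T)).
  apply: le_trans _ (H2 _); last by rewrite le_max lexx orbT.
  by rewrite (le_trans EE)// mulrDl mul1r lerD2r.
apply: le_trans _ (H1 _); last by rewrite le_max lexx.
by rewrite (le_trans EE)// mulrDl mul1r lerD2l ler_pM2l// ltW.
Qed.
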